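(* Let $a\in\mathbb R$, $\lambda>0$, $\varepsilon,\Delta x,\Delta t,T>0$, $\sigma=\Delta t/\Delta x$. Let $(\mathbf U_j^n)_{j\in\mathbb Z,n\in\mathbb N}$, $\mathbf U_j^n=(u_j^n,v_j^n)^\top$, be generated by the staggered scheme, let $(\bar u_j^n)_{j\in\mathbb Z,n\in\mathbb N}$ be a solution of the limiting staggered scheme (both given in the context), and set $\bar{\mathbf U}_j^n=(\bar u_j^n,a\bar u_j^n)^\top$, $w_j^n=v_j^n-au_j^n$. Assume $|a|<\lambda$ and $\lambda\sigma\le\frac1{\sqrt3}$, and define $$\kappa_\sigma=\frac{(\lambda^2-a^2)\sigma^2}{2(1-\lambda^2\sigma^2)}.$$ Assume moreover that: - $\Phi_{\mathrm{rel}}^0<+\infty$; - there exist two constant equilibrium states $\mathbf U_\pm=(u_\pm,au_\pm)^\top$ such that, for every $n\in\mathbb N$, $\lim_{j\to\pm\infty}\mathbf U_j^n=\mathbf U_\pm$ and $\lim_{j\to\pm\infty}\bar{\mathbf U}_j^n=\mathbf U_\pm$; - there exists $K>0$ such that, for every $N\in\mathbb N$ with $N\Delta t\le T$, $$\sum_{n=0}^{N-1}\Delta t\,\Delta x\sum_{j\in\mathbb Z}\Bigl(\frac{\bar u_{j+1}^n-\bar u_j^n}{\Delta x}\Bigr)^2\le K^2.$$ Then, for every $N\in\mathbb N$ with $N\Delta t\le T$, $$\Phi_{\mathrm{rel}}^N+\kappa_\sigma\frac{\Delta t}{\varepsilon}\Delta x\sum_{j\in\mathbb Z}(w_j^N)^2\le\Phi_{\mathrm{rel}}^0+\kappa_\sigma\frac{\Delta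 t}{\varepsilon}\Delta x\sum_{j\in\mathbb Z}(w_j^0)^2+\frac{(\lambda^2-a^2)^2}{2}\varepsilon K^2.$$
   Context: Staggered scheme: intermediate states $\mathbf U_{j+\frac12}^{n+\frac12}=(u_{j+\frac12}^{n+\frac12},v_{j+\frac12}^{n+\frac12})^\top$ live at interfaces. For $j\in\mathbb Z$, $n\in\mathbb N$, with $e:=e^{-\Delta t/(2\varepsilon)}$, $$u_{j-\frac12}^{n+\frac12}=\tfrac{u_{j-1}^n+u_j^n}{2}-\tfrac\sigma2\Bigl(au_j^n+e(v_j^n-au_j^n)-au_{j-1}^n-e(v_{j-1}^n-au_{j-1}^n)\Bigr),$$ $$v_{j-\frac12}^{n+\frac12}=\Bigl(1+\tfrac{\Delta t}{2\varepsilon}\Bigr)^{-1}\Bigl[\tfrac{v_{j-1}^n+v_j^n}{2}-\tfrac{\lambda^2\sigma}{2}(u_j^n-u_{j-1}^n)+\tfrac{\Delta t}{2\varepsilon}a\,u_{j-\frac12}^{n+\frac12}\Bigr],$$ $$u_j^{n+1}=\tfrac{u_{j-\frac12}^{n+\frac12}+u_{j+\frac12}^{n+\frac12}}{2}-\tfrac\sigma2\Bigl(au_{j+\frac12}^{n+\frac12}+e(v_{j+\frac12}^{n+\frac12}-au_{j+\frac12}^{n+\frac12})-au_{j-\frac12}^{n+\frac12}-e(v_{j-\frac12}^{n+\frac12}-au_{j-\frac12}^{n+\frac12})\Bigr),$$ $$v_j^{n+1}=\Bigl(1+\tfrac{\Delta t}{2\varepsilon}\Bigr)^{-1}\Bigl[\tfrac{v_{j-\frac12}^{n+\frac12}+v_{j+\frac12}^{n+\frac12}}{2}-\tfrac{\lambda^2\sigma}{2}(u_{j+\frac12}^{n+\frac12}-u_{j-\frac12}^{n+\frac12})+\tfrac{\Delta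 t}{2\varepsilon}a\,u_j^{n+1}\Bigr].$$ Limiting staggered scheme: $$\bar u_{j-\frac12}^{n+\frac12}=\tfrac{\bar u_{j-1}^n+\bar u_j^n}{2}-\tfrac{a\sigma}{2}(\bar u_j^n-\bar u_{j-1}^n),\qquad \bar u_j^{n+1}=\tfrac{\bar u_{j-\frac12}^{n+\frac12}+\bar u_{j+\frac12}^{n+\frac12}}{2}-\tfrac{a\sigma}{2}(\bar u_{j+\frac12}^{n+\frac12}-\bar u_{j-\frac12}^{n+\frac12}).$$ Global discrete relative entropy: with $H=\begin{pmatrix}\lambda^2&-a\\-a&1\end{pmatrix}$, $$\Phi_{\mathrm{rel}}^n=\frac{\Delta x}{2}\sum_{j\in\mathbb Z}(\mathbf U_j^n-\bar{\mathbf U}_j^n)^\top H(\mathbf U_j^n-\bar{\mathbf U}_j^n).$$ *)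

(* Defs.v *)
From mathcomp Require Import all_boot all_order all_algebra.
From mathcomp Require Import all_classical all_reals all_analysis.

Set Implicit Arguments.
Unset Strict Implicit.
Unset Printing Implicit Defensive.

Import Order.TTheory GRing.Theory Num.Theory.
Import numFieldNormedType.Exports.

Local Open Scope classical_set_scope.
Local Open Scope ring_scope.

(* u n j and v n j are u_j^n and v_j^n, while uh n j and vh n j are
   u_{j-1/2}^{n+1/2} and v_{j-1/2}^{n+1/2}: interface j-1/2 has index j and
   interface j+1/2 has index j+1. *)
Definition staggered_scheme (R : realType) (a lambda eps dt sigma : R)
    (u v uh vh : nat -> int -> R) : Prop :=
  let e := expR (- (dt / (2 * eps))) in
  forall (n : nat) (j : int),
  [/\ uh n j = (u n (j - 1) + u n j) / 2
        - sigma / 2 * (a * u n j + e * (v n j - a * u n j)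
                       - a * u n (j - 1)
                       - e * (v n (j - 1) - a * u n (j - 1))),
      vh n j = (1 + dt / (2 * eps))^-1
        * ((v n (j - 1) + v n j) / 2
           - lambda ^+ 2 * sigma / 2 * (u n j - u n (j - 1))
           + dt / (2 * eps) * a * uh n j),
      u n.+1 j = (uh n j + uh n (j + 1)) / 2
        - sigma / 2 * (a * uh n (j + 1)
                       + e * (vh n (j + 1) - a * uh n (j + 1))
                       - a * uh n j
                       - e * (vh n j - a * uh n j)) &
      v n.+1 j = (1 + dt / (2 * eps))^-1
        * ((vh n j + vh n (j + 1)) / 2
           - lambda ^+ 2 * sigma / 2 * (uh n (j + 1) - uh n j)
           + dt / (2 * eps) * a * u n.+1 j)].

Definition limiting_scheme (R : realType) (a sigma : R)
    (ubar ubarh : nat -> int -> R) : Prop :=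
  forall (n : nat) (j : int),
    ubarh n j = (ubar n (j - 1) + ubar n j) / 2
      - a * sigma / 2 * (ubar n j - ubar n (j - 1)) /\
    ubar n.+1 j = (ubarh n j + ubarh n (j + 1)) / 2
      - a * sigma / 2 * (ubarh n (j + 1) - ubarh n j).

Definition state (R : realType) (u v : R) : 'cV[R]_2 :=
  \col_(i < 2) [:: u; v]`_i.

Definition entropy_mx (R : realType) (a lambda : R) : 'M[R]_2 :=
  \matrix_(i < 2, j < 2)
    (nth [::] [:: [:: lambda ^+ 2; - a]; [:: - a; 1]] i)`_j.

(* The sum is the usual one, with values in [0, +oo], whenever entropy_mx is
   positive semidefinite, i.e. |a| <= |lambda|. *)
Definition Phi_rel (R : realType) (a lambda dx : R)
    (U Ubar : int -> 'cV[R]_2) : \bar R :=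
  ((dx / 2)%:E * \esum_(j in [set: int])
     (((U j - Ubar j)^T *m entropy_mx a lambda *m (U j - Ubar j)) 0 0)%:E)%E.

Definition kappa (R : realType) (a lambda sigma : R) : R :=
  (lambda ^+ 2 - a ^+ 2) * sigma ^+ 2 / (2 * (1 - lambda ^+ 2 * sigma ^+ 2)).

(* Limits as j tends to +oo and -oo of a sequence indexed by the integers. *)
Definition cvg_pinfty_int (R : realType) (U : int -> 'cV[R]_2) (l : 'cV[R]_2) :
  Prop := U k%:Z @[k --> \oo] --> l.

Definition cvg_ninfty_int (R : realType) (U : int -> 'cV[R]_2) (l : 'cV[R]_2) :
  Prop := U (- k%:Z) @[k --> \oo] --> l.

(* Main.v *)
Require Import Defs.
From mathcomp Require Import all_boot all_order all_algebra.
From mathcomp Require Import all_classical all_reals all_analysis.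
From mathcomp Require Import ring lra.

Set Implicit Arguments.
Unset Strict Implicit.
Unset Printing Implicit Defensive.

Import Order.TTheory GRing.Theory Num.Theory.
Import numFieldNormedType.Exports.

Local Open Scope classical_set_scope.
Local Open Scope ring_scope.

(** Write mu = lambda^2 - a^2, r = dt / (2 eps), e = expR (- r), p = u - ubar
    and w = v - a u.  The relative entropy density is mu p^2 + w^2
    ([quadratic_entropy]), so each side of the estimate is, up to the factor
    dx / 2, the sum over j of mu p^2 + (1 + c) w^2 with c = 2 kappa dt / eps,
    plus the source term.  A time step consists of two half steps of the same
    form, and it is enough to follow this sum, [energy], through one of them.

    Over one cell, with xbar the mean and dx_ the jump of a quantity x, a half
    step reads
      p' = pbar - sigma / 2 (a dp_ + e dw_),
      (1 + r) w' = wbar - sigma / 2 (mu dp_ - a e dw_ + mu dub_),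
    where dub_ is the jump of ubar.  For r = 0 and e = 1 it is a
    Lax-Friedrichs step for a system which is symmetric for mu p^2 + w^2 and
    has characteristic speeds lambda and - lambda; means and jumps then
    produce a discrete flux difference and a dissipation of jumps.  In general
    the forcing by dub_ is first removed by a Young inequality adapted to the
    factor (1 + r)^-1 ([relaxation_young]), at the price of
    mu^2 sigma^2 dub_^2 / (4 r) and of replacing (1 + c) / (1 + r)^2 by
    B = (1 + c) / (1 + r + r (r - c)).  Since lambda^2 sigma^2 <= 1/3, the
    definition of kappa gives c <= r, hence B and e both lie between
    max(0, 1 - r) and 1.  Up to a flux difference, what remains is the
    nonnegativity of a quadratic form in wbar, dp_, dw_, obtained by completing
    squares; the weight c is what absorbs the cross term (B - e) wbar dp_, and
    (B - e)^2 <= r is all that this requires.  This is [cell_entropy].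

    The fluxes are bounded by the energy density, so they cancel in the sum
    over the integers as soon as the energy is finite ([esum_le_flux]).  The
    jumps of ubar do not increase in square sum from one half step to the next
    ([jump_energy_le]), so both half steps are controlled by the jumps at the
    integer time.  Summing in time gives the theorem, the constants being
    arranged so that the source is exactly mu^2 / 2 * eps times the quantity
    bounded by K^2. *)

(** * The inequality in one cell *)

(** With h = 1 + c and M = 1 + r + r (r - c), so that (1 + r)^2 = M + r h, the
    difference of the two sides is a positive multiple of (r h Y + M G)^2. *)
Lemma relaxation_young (R : realFieldType) (r c Y G : R) :
  0 < r -> 0 <= c -> c <= r ->
  (1 + c) * ((1 + r)^-1 * (Y - G)) ^+ 2 <=
  (1 + c) / (1 + r + r * (r - c)) * Y ^+ 2 + G ^+ 2 / r.
Proof.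
move=> r0 c0 cr; set M := 1 + r + r * (r - c).
have rc0 : 0 <= r * (r - c) by rewrite mulr_ge0 ?subr_ge0 // ltW.
have M0 : 0 < M by rewrite /M; lra.
have hM : (1 + r) ^+ 2 = M + r * (1 + c) by rewrite /M; ring.
have r1 : 1 + r != 0 by rewrite lt0r_neq0 //; lra.
rewrite -subr_ge0.
have -> : (1 + c) / M * Y ^+ 2 + G ^+ 2 / r
          - (1 + c) * ((1 + r)^-1 * (Y - G)) ^+ 2
        = (r * (1 + c) * Y + M * G) ^+ 2 / (r * M * (1 + r) ^+ 2).
  rewrite exprMn exprVn hM; field.
  by rewrite -hM (expf_neq0 _ r1) (lt0r_neq0 M0) (lt0r_neq0 r0).
by apply: divr_ge0; rewrite ?sqr_ge0 //; apply: mulr_ge0 (sqr_ge0 _);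
  apply: mulr_ge0; exact: ltW.
Qed.

Lemma relaxation_coef_bounds (R : realFieldType) (r c : R) :
  0 < r -> 0 <= c -> c <= r ->
  let B := (1 + c) / (1 + r + r * (r - c)) in
  [/\ 0 <= B, 1 - r <= B & B <= 1].
Proof.
move=> r0 c0 cr B.
have rc0 : 0 <= r * (r - c) by rewrite mulr_ge0 ?subr_ge0 // ltW.
have M0 : 0 < 1 + r + r * (r - c) by lra.
have B0 : 0 <= B by rewrite /B divr_ge0 //; lra.
split => //.
  have [r1|r1] := leP 1 r; first by lra.
  rewrite /B ler_pdivlMr //.
  have := mulr_ge0 (mulr_ge0 (ltW r0) (ltW r0)) (ltW r0).
  have := mulr_ge0 (mulr_ge0 (ltW r0) c0) (ltW (_ : 0 < 1 - r)).
  by rewrite subr_gt0 => /(_ r1); nra.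
by rewrite /B ler_pdivrMr //; lra.
Qed.

Lemma sqr_diff_le (R : realFieldType) (r x y : R) :
  0 <= x <= 1 -> 0 <= y <= 1 -> 1 - r <= x -> 1 - r <= y ->
  (x - y) ^+ 2 <= r.
Proof.
move=> /andP[x0 x1] /andP[y0 y1] xr yr; rewrite expr2.
by have [xy|xy] := leP x y; nra.
Qed.

(** The numerical entropy flux.  Its first two terms make the products of means
    and jumps coming from the p equation telescope; the coefficient of w^2
    cancels the product of the mean and the jump of w that remains. *)
Definition flux (R : realFieldType) (mu a sigma e c r p w : R) : R :=
  sigma * a * mu / 2 * p ^+ 2 + e * sigma * mu * (p * w)
  - (1 + c) / (1 + r + r * (r - c)) * (a * sigma * e) / 2 * w ^+ 2.

(** The factor (mu + a^2) sigma^2 is lambda^2 sigma^2, and the relation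
    satisfied by c is c = 4 r kappa. *)
Lemma cell_entropy (R : realFieldType) (mu a sigma r e c p1 p2 w1 w2 d : R) :
  0 < mu -> 0 < r -> (mu + a ^+ 2) * sigma ^+ 2 <= 3^-1 ->
  0 <= e <= 1 -> 1 - r <= e ->
  c * (1 - (mu + a ^+ 2) * sigma ^+ 2) = 2 * r * (mu * sigma ^+ 2) ->
  mu * ((p1 + p2) / 2 - sigma / 2 * (a * (p2 - p1) + e * (w2 - w1))) ^+ 2
  + (1 + c) * ((1 + r)^-1 * ((w1 + w2) / 2
      - sigma / 2 * (mu * (p2 - p1) - a * e * (w2 - w1) + mu * d))) ^+ 2 <=
  (mu * p1 ^+ 2 + (1 + c) * w1 ^+ 2 + (mu * p2 ^+ 2 + (1 + c) * w2 ^+ 2)) / 2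
  + mu ^+ 2 * sigma ^+ 2 / (4 * r) * d ^+ 2
  + (flux mu a sigma e c r p1 w1 - flux mu a sigma e c r p2 w2).
Proof.
move=> mu0 r0 s3 e01 er cE.
set s := (mu + a ^+ 2) * sigma ^+ 2 in s3 cE.
have m0 : 0 <= mu * sigma ^+ 2 by rewrite mulr_ge0 ?sqr_ge0 // ltW.
have ms : mu * sigma ^+ 2 <= s.
  by rewrite /s mulrDl lerDl mulr_ge0 // sqr_ge0.
have s1 : 0 < 1 - s by lra.
have c0 : 0 <= c.
  by rewrite -(pmulr_lge0 _ s1) cE mulr_ge0 //; lra.
have cr : c <= r.
  by rewrite -(ler_pM2r s1) cE -mulrA mulrCA ler_pM2l //; lra.
have [B0 rB B1] := relaxation_coef_bounds r0 c0 cr.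
rewrite /flux; set B := _ / _ in B0 rB B1 *.
pose x := (w1 + w2) / 2; pose z := (w2 - w1) / 2; pose q := (p2 - p1) / 2.
pose Y := x - sigma * mu * q + sigma * a * e * z.
have -> : (w1 + w2) / 2
      - sigma / 2 * (mu * (p2 - p1) - a * e * (w2 - w1) + mu * d)
    = Y - sigma * mu * d / 2 by rewrite /Y /x /z /q; field.
have := relaxation_young Y (sigma * mu * d / 2) r0 c0 cr; rewrite -/B => young.
have -> : mu ^+ 2 * sigma ^+ 2 / (4 * r) * d ^+ 2 = (sigma * mu * d / 2) ^+ 2 / r.
  by field; rewrite lt0r_neq0.
have e2s : e ^+ 2 * s <= 1.
  have : e ^+ 2 <= 1 by rewrite expr_le1 //; case/andP: e01.
  have s0 : 0 <= s by lra.
  have := sqr_ge0 e; nra.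
have Be := sqr_diff_le (_ : 0 <= B <= 1) e01 rB er.
have {}Be : (B - e) ^+ 2 <= r by apply: Be; rewrite B0 B1.
have quadx : 0 <= (1 + c - B) * (1 - s) - mu * sigma ^+ 2 * (B - e) ^+ 2.
  have : mu * sigma ^+ 2 * (B - e) ^+ 2 <= mu * sigma ^+ 2 * r by apply: ler_wpM2l.
  have : 0 <= (1 - B) * (1 - s) by rewrite mulr_ge0 //; lra.
  have : 0 <= mu * sigma ^+ 2 * r by rewrite mulr_ge0 // ltW.
  nra.
(* The right-hand side minus the left-hand side is main plus the slack of
   young: this decomposition into squares is the heart of the estimate. *)
have main : 0 <= (1 - B) * (sigma * mu * q - a * sigma * e * z) ^+ 2
   + (1 + c - e ^+ 2 * s) * z ^+ 2
   + ((1 - s) ^-1 * (mu * ((1 - s) * q + sigma * (B - e) * x) ^+ 2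
      + ((1 + c - B) * (1 - s) - mu * sigma ^+ 2 * (B - e) ^+ 2) * x ^+ 2)).
  apply: addr_ge0; first apply: addr_ge0.
  - by rewrite mulr_ge0 ?sqr_ge0 // subr_ge0.
  - by rewrite mulr_ge0 ?sqr_ge0 //; lra.
  - rewrite mulr_ge0 ?invr_ge0 ?(ltW s1) // addr_ge0 //.
      by rewrite mulr_ge0 ?sqr_ge0 // ltW.
    by rewrite mulr_ge0 ?sqr_ge0.
rewrite -subr_ge0; rewrite -subr_ge0 in young.
apply: (le_trans (addr_ge0 young main)); rewrite le_eqVlt; apply/orP; left; apply/eqP.
set W := (1 + c) * _; set V := _ / r.
rewrite /Y /x /z /q /s; field.
rewrite -/s lt0r_neq0 //.
Qed.

(** * Sums over the integers *)

Lemma esum_shift (R : realType) (F : int -> \bar R) (k : int) :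
  (\esum_(j in [set: int]) F (j + k)%R = \esum_(j in [set: int]) F j)%E.
Proof.
rewrite [RHS](reindex_esum [set: int] [set: int] (fun j : int => j + k)) //.
split => //; first by move=> x y _ _ /addIr.
by move=> y _; exists (y - k) => //; rewrite subrK.
Qed.

Lemma esumZ (R : realType) (T : choiceType) (D : set T) (k : R)
    (F : T -> \bar R) : 0 <= k -> (forall i, (0 <= F i)%E) ->
  (\esum_(i in D) (k%:E * F i) = k%:E * \esum_(i in D) F i)%E.
Proof.
move=> k_ge0 F0; have [->|kn0] := eqVneq k 0.
  by rewrite mul0e esum1 // => i _; rewrite mul0e.
have k0 : 0 < k by rewrite lt_neqAle eq_sym kn0.
have le (c : R) (G : T -> \bar R) : 0 < c -> (forall i, (0 <= G i)%E) ->
    (\esum_(i in D) (c%:E * G i) <= c%:E * \esum_(i in D) G i)%E.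
  move=> c0 G0; apply: ge_ereal_sup => _ [X XD <-].
  rewrite -ge0_mule_fsumr // lee_pmul2l ?fin_numE ?lte_fin //.
  by apply: ereal_sup_ubound; exists X.
apply/eqP; rewrite eq_le le //= -lee_pdivlMl //.
apply: le_trans (le k^-1 _ _ _); last 2 first.
- by rewrite invr_gt0.
- by move=> i; rewrite mule_ge0 // lee_fin ltW.
by apply: le_esum => i _; rewrite muleA -EFinM mulVf ?mul1e // lt0r_neq0.
Qed.

(** Summation of a local balance law.  The summands f are not of constant sign,
    so the telescoping is done on C F + f, which is nonnegative and summable
    when F is. *)
Lemma esum_le_flux (R : realType) (F F' S f : int -> R) (C : R) :
  (forall j, 0 <= F j) -> (forall j, 0 <= F' j) -> (forall j, 0 <= S j) ->
  0 <= C -> (forall j, `|f j| <= C * F j) ->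
  (forall j, F' j <= F j + S j + (f (j - 1) - f j)) ->
  (\esum_(j in [set: int]) (F' j)%:E <=
   \esum_(j in [set: int]) (F j)%:E + \esum_(j in [set: int]) (S j)%:E)%E.
Proof.
move=> F0 F'0 S0 C0 fC F'le.
have es0 (G : int -> R) : (forall j, 0 <= G j) ->
    (0 <= \esum_(j in [set: int]) (G j)%:E)%E.
  by move=> G0; apply: esum_ge0 => j _; rewrite lee_fin.
have [Foo|Foo] := eqVneq (\esum_(j in [set: int]) (F j)%:E)%E +oo%E.
  by rewrite Foo addye ?leey // -ltNye (lt_le_trans (ltNyr 0)) // es0.
have Ffin : (\esum_(j in [set: int]) (F j)%:E)%E \is a fin_num.
  by rewrite ge0_fin_numE ?es0 // lt_neqAle Foo leey.
pose g j := C * F j + f j.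
have g0 j : 0 <= g j by have := fC j; rewrite ler_norml /g => /andP[]; lra.
have CF0 j : 0 <= C * F j by rewrite mulr_ge0.
have esD (G H : int -> R) : (forall j, 0 <= G j) -> (forall j, 0 <= H j) ->
    (\esum_(j in [set: int]) (G j + H j)%:E =
     \esum_(j in [set: int]) (G j)%:E + \esum_(j in [set: int]) (H j)%:E)%E.
  move=> G0 H0; under eq_esum do rewrite EFinD.
  by rewrite esumD // => j _; rewrite lee_fin.
have shift (G : int -> R) : (\esum_(j in [set: int]) (G (j - 1))%:E =
    \esum_(j in [set: int]) (G j)%:E)%E.
  exact: (esum_shift (fun j => (G j)%:E)).
have bfin (G : int -> R) (D : R) : 0 < D -> (forall j, 0 <= G j <= D * F j) ->
    (\esum_(j in [set: int]) (G j)%:E)%E \is a fin_num.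
  move=> D0 GD.
  rewrite ge0_fin_numE; last by apply: es0 => j; case/andP: (GD j).
  apply: (@le_lt_trans _ _ (\esum_(j in [set: int]) (D%:E * (F j)%:E))%E).
    by apply: le_esum => j _; rewrite -EFinM lee_fin; case/andP: (GD j).
  rewrite (esumZ _ (ltW D0)) //.
  by rewrite ltey_eq fin_numM.
have C1 : 0 < C + C + 1 by lra.
have gfin : (\esum_(j in [set: int]) (g j)%:E)%E \is a fin_num.
  apply: (bfin g (C + C + 1)) => // j; rewrite g0 /= /g.
  have := fC j; have := F0 j; rewrite ler_norml => ? /andP[_].
  by rewrite !mulrDl; lra.
have CFfin : (\esum_(j in [set: int]) (C * F j)%:E)%E \is a fin_num.
  apply: (bfin _ (C + C + 1)) => // j; rewrite CF0 /= !mulrDl.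
  by have := F0 j; have := CF0 j; lra.
have key : (\esum_(j in [set: int]) (F' j + (g j + C * F (j - 1)))%:E <=
            \esum_(j in [set: int]) (F j + S j + (g (j - 1) + C * F j))%:E)%E.
  apply: le_esum => j _; rewrite lee_fin /g; have := F'le j; lra.
move: key; clearbody g; rewrite !esD //; try by move=> j; rewrite ?addr_ge0.
rewrite (shift g) (shift (fun j => C * F j)) leeD2rE //.
by rewrite fin_numD gfin.
Qed.

(** * Half steps *)

(** Half a time step of the staggered scheme, with r = dt / (2 eps): the value
    of index j at the new time is computed from those of indices j - 1 and j. *)
Definition staggered_half_step (R : realType) (a lambda sigma r e : R)
    (u v u' v' : int -> R) : Prop :=
  forall j : int,
    u' j = (u (j - 1) + u j) / 2
      - sigma / 2 * (a * u j + e * (v j - a * u j)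
                     - a * u (j - 1) - e * (v (j - 1) - a * u (j - 1))) /\
    v' j = (1 + r)^-1 * ((v (j - 1) + v j) / 2
      - lambda ^+ 2 * sigma / 2 * (u j - u (j - 1)) + r * a * u' j).

(** The same for the limiting scheme. *)
Definition limiting_half_step (R : realType) (a sigma : R)
    (b b' : int -> R) : Prop :=
  forall j : int,
    b' j = (b (j - 1) + b j) / 2 - a * sigma / 2 * (b j - b (j - 1)).

(** The relative entropy of (u, v) with respect to (b, a b), without the factor
    dx / 2, with an extra weight c on the distance v - a u to equilibrium. *)
Definition energy (R : realType) (mu a c : R) (u v b : int -> R) : \bar R :=
  (\esum_(j in [set: int])
     (mu * (u j - b j) ^+ 2 + (1 + c) * (v j - a * u j) ^+ 2)%:E)%E.

(** The sum of the squares of the jumps of b. *)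
Definition jump_energy (R : realType) (b : int -> R) : \bar R :=
  (\esum_(j in [set: int]) ((b j - b (j - 1)) ^+ 2)%:E)%E.

(** The jumps of b' are convex combinations, with weights (1 + a sigma) / 2 and
    (1 - a sigma) / 2, of two neighbouring jumps of b. *)
Lemma jump_energy_le (R : realType) (a sigma : R) (b b' : int -> R) :
  (a * sigma) ^+ 2 <= 1 -> limiting_half_step a sigma b b' ->
  (jump_energy b' <= jump_energy b)%E.
Proof.
move=> as1 bb'; set t := a * sigma in as1.
have /andP[t1 t2] : -1 <= t <= 1.
  by rewrite -ler_norml -(@ler_pXn2r _ 2) // ?nnegrE // real_normK ?num_real // expr1n.
pose d j := b j - b (j - 1).
rewrite /jump_energy.
apply: le_trans (_ : _ <= \esum_(j in [set: int]) (d j ^+ 2)%:E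
   + \esum_(j in [set: int]) (0 : R)%:E)%E _; last by rewrite [X in (_ + X)%E]esum1 // adde0.
apply: (@esum_le_flux _ _ _ _ (fun j => (1 + t) / 2 * d j ^+ 2) 1).
- by move=> j; apply: sqr_ge0.
- by move=> j; apply: sqr_ge0.
- by [].
- by [].
- move=> j; have := sqr_ge0 (d j).
  rewrite ger0_norm; first by nra.
  by rewrite mulr_ge0 ?sqr_ge0 //; lra.
move=> j; have -> : b' j - b' (j - 1) = (1 + t) / 2 * d (j - 1) + (1 - t) / 2 * d j.
  by rewrite !bb' /d -/t; field.
have : 0 <= (1 + t) * (1 - t) * (d (j - 1) - d j) ^+ 2.
  by rewrite mulr_ge0 ?sqr_ge0 // mulr_ge0 //; lra.
by nra.
Qed.

Lemma flux_le (R : realFieldType) (A B D mu c p w : R) : 0 < mu -> 0 <= c ->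
  `|A * p ^+ 2 + B * (p * w) - D * w ^+ 2| <=
  (`|A| + `|B| + `|D|) * (1 + mu^-1) * (mu * p ^+ 2 + (1 + c) * w ^+ 2).
Proof.
move=> mu0 c0.
have pq : p ^+ 2 + w ^+ 2 <= (1 + mu^-1) * (mu * p ^+ 2 + (1 + c) * w ^+ 2).
  have -> : (1 + mu^-1) * (mu * p ^+ 2 + (1 + c) * w ^+ 2)
    = p ^+ 2 + w ^+ 2 + (mu * p ^+ 2 + c * w ^+ 2 + mu^-1 * ((1 + c) * w ^+ 2)).
    by field; rewrite lt0r_neq0.
  rewrite lerDl; apply: addr_ge0; first apply: addr_ge0.
  - by rewrite mulr_ge0 ?sqr_ge0 // ltW.
  - by rewrite mulr_ge0 ?sqr_ge0.
  - by rewrite mulr_ge0 ?invr_ge0 ?(ltW mu0) // mulr_ge0 ?sqr_ge0 ?addr_ge0.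
rewrite -mulrA; apply: le_trans (ler_wpM2l _ pq); last by rewrite !addr_ge0.
apply: le_trans (ler_normB _ _) _; apply: le_trans (lerD (ler_normD _ _) (lexx _)) _.
rewrite (normrM A) (normrM B) (normrM D) (normrM p w) !normrX -[p ^+ 2]real_normK ?num_real // -[w ^+ 2]real_normK ?num_real //.
have := sqr_ge0 (`|p| - `|w|).
have := normr_ge0 A; have := normr_ge0 B; have := normr_ge0 D.
have := normr_ge0 p; have := normr_ge0 w.
move: `|A| `|B| `|D| `|p| `|w| => A' B' D' p' w' w0 p0 D0 B0 A0 pw.
have : 0 <= B' * (p' ^+ 2 + w' ^+ 2 - p' * w').
  apply: mulr_ge0 => //; nra.
have := mulr_ge0 A0 (sqr_ge0 w'); have := mulr_ge0 D0 (sqr_ge0 p').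
rewrite !mulrDl !mulrDr mulrN. lra.
Qed.

Lemma energy_half_step (R : realType) (mu a lambda sigma r e c : R)
    (u v u' v' b b' : int -> R) :
  mu = lambda ^+ 2 - a ^+ 2 -> 0 < mu -> 0 < r ->
  lambda ^+ 2 * sigma ^+ 2 <= 3^-1 ->
  0 <= e <= 1 -> 1 - r <= e ->
  0 <= c -> c * (1 - lambda ^+ 2 * sigma ^+ 2) = 2 * r * (mu * sigma ^+ 2) ->
  staggered_half_step a lambda sigma r e u v u' v' ->
  limiting_half_step a sigma b b' ->
  (energy mu a c u' v' b' <=
   energy mu a c u v b + (mu ^+ 2 * sigma ^+ 2 / (4 * r))%:E * jump_energy b)%E.
Proof.
move=> muE mu0 r0 s3 e01 er c0 cE uv bb'.
have lE : lambda ^+ 2 = mu + a ^+ 2 by rewrite muE subrK.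
rewrite lE in s3 cE.
have mu_ge0 := ltW mu0; have c1 : 0 <= 1 + c by lra.
pose p j := u j - b j; pose w j := v j - a * u j; pose d j := b j - b (j - 1).
pose F j := mu * p j ^+ 2 + (1 + c) * w j ^+ 2.
have F0 j : 0 <= F j.
  by apply: addr_ge0; apply: mulr_ge0 => //; apply: sqr_ge0.
have k0 : 0 <= mu ^+ 2 * sigma ^+ 2 / (4 * r).
  apply: divr_ge0; last by rewrite mulr_ge0 // ltW.
  by rewrite mulr_ge0 ?sqr_ge0.
rewrite /energy /jump_energy -esumZ //; last by move=> j; rewrite lee_fin sqr_ge0.
have step j := cell_entropy (p (j - 1)) (p j) (w (j - 1)) (w j) (d j)
               mu0 r0 s3 e01 er cE.
pose A := sigma * a * mu / 2; pose B := e * sigma * mu.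
pose D := (1 + c) / (1 + r + r * (r - c)) * (a * sigma * e) / 2.
(* The term F j / 2 turns the mean of F (j - 1) and F j into F j plus a flux
   difference. *)
pose f j := flux mu a sigma e c r (p j) (w j) + F j / 2.
apply: (@esum_le_flux _ F _ _ f ((`|A| + `|B| + `|D|) * (1 + mu^-1) + 1)) => //.
- by move=> j; apply: addr_ge0; apply: mulr_ge0 => //; apply: sqr_ge0.
- by move=> j; rewrite mulr_ge0 ?sqr_ge0.
- apply: addr_ge0 => //; apply: mulr_ge0; first by rewrite !addr_ge0.
  by rewrite addr_ge0 ?invr_ge0 // ltW.
- move=> j; apply: le_trans (ler_normD _ _) _; rewrite [leRHS]mulrDl mul1r lerD //.
    exact: flux_le.
  by rewrite ger0_norm ?divr_ge0 //; have := F0 j; lra.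
move=> j; have [u'E v'E] := uv j.
have -> : u' j - b' j = (p (j - 1) + p j) / 2
    - sigma / 2 * (a * (p j - p (j - 1)) + e * (w j - w (j - 1))).
  by rewrite u'E bb' /p /w; field.
have -> : v' j - a * u' j = (1 + r)^-1 * ((w (j - 1) + w j) / 2
    - sigma / 2 * (mu * (p j - p (j - 1)) - a * e * (w j - w (j - 1)) + mu * d j)).
  rewrite v'E {2}u'E u'E lE /p /w /d; field.
  by rewrite lt0r_neq0 //; lra.
apply: le_trans (step j) _; rewrite /f /F /d; lra.
Qed.

(** * Time steps *)

Lemma quadratic_entropy (R : realType) (a lambda u v u' v' : R) :
  ((state u v - state u' v')^T *m entropy_mx a lambda
     *m (state u v - state u' v')) 0 0 =
  lambda ^+ 2 * (u - u') ^+ 2 - 2 * a * (u - u') * (v - v') + (v - v') ^+ 2.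
Proof.
rewrite !mxE !big_ord_recl big_ord0 !mxE !big_ord_recl !big_ord0 !mxE /=.
by ring.
Qed.

Lemma telescope_sume_le (R : realType) (A D : nat -> \bar R) (C : R) (N : nat) :
  0 <= C -> (forall n, (0 <= D n)%E) ->
  (forall n, (n < N)%N -> (A n.+1 <= A n + C%:E * D n)%E) ->
  (A N <= A 0%N + C%:E * \sum_(0 <= n < N) D n)%E.
Proof.
move=> C0 D0; elim: N => [_|N IH step]; first by rewrite big_geq // mule0 adde0.
rewrite big_nat_recr //= ge0_muleDr // ?sume_ge0 // addeA.
apply: le_trans (step _ (ltnSn N)) _; rewrite leeD2r // IH // => n nN.
by apply: step; rewrite ltnS ltnW.
Qed.

Lemma energy_step (R : realType) (a lambda eps dt sigma : R)
    (u v uh vh ubar ubarh : nat -> int -> R) (n : nat) :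
  let c := 2 * (kappa a lambda sigma * (dt / eps)) in
  let mu := lambda ^+ 2 - a ^+ 2 in
  0 < eps -> 0 < dt -> 0 < mu -> lambda ^+ 2 * sigma ^+ 2 <= 3^-1 ->
  staggered_scheme a lambda eps dt sigma u v uh vh ->
  limiting_scheme a sigma ubar ubarh ->
  (energy mu a c (u n.+1) (v n.+1) (ubar n.+1) <=
   energy mu a c (u n) (v n) (ubar n)
   + (mu ^+ 2 * sigma ^+ 2 * eps / dt)%:E * jump_energy (ubar n))%E.
Proof.
move=> c mu eps0 dt0 mu0 s3 U L.
have edt : 0 < dt / (2 * eps) by rewrite divr_gt0 // mulr_gt0.
set r := dt / (2 * eps) in edt.
set e := expR (- r).
have s1 : 0 < 1 - lambda ^+ 2 * sigma ^+ 2 by lra.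
have kge0 : 0 <= kappa a lambda sigma.
  by rewrite /kappa -/mu divr_ge0 // mulr_ge0 ?sqr_ge0 // ltW.
have c0 : 0 <= c by rewrite /c mulr_ge0 // mulr_ge0 // divr_ge0 // ltW.
have cE : c * (1 - lambda ^+ 2 * sigma ^+ 2) = 2 * r * (mu * sigma ^+ 2).
  rewrite /c /kappa /r -/mu; field.
  by rewrite exprMn (lt0r_neq0 s1) (lt0r_neq0 eps0).
have e01 : 0 <= e <= 1 by rewrite expR_ge0 /= -expR0 ler_expR oppr_le0 ltW.
have er : 1 - r <= e by apply: expR_ge1Dx.
have as1 : (a * sigma) ^+ 2 <= 1.
  have : 0 <= mu * sigma ^+ 2 by rewrite mulr_ge0 ?sqr_ge0 // ltW.
  by rewrite exprMn /mu mulrBl; lra.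
have jump0 b : (0 <= jump_energy b)%E.
  by apply: esum_ge0 => j _; rewrite lee_fin sqr_ge0.
have k0 : 0 <= mu ^+ 2 * sigma ^+ 2 / (4 * r).
  apply: divr_ge0; last by rewrite mulr_ge0 // ltW.
  by rewrite mulr_ge0 ?sqr_ge0.
have H1 : staggered_half_step a lambda sigma r e (u n) (v n) (uh n) (vh n).
  by move=> j; have [] := U n j.
have L1 : limiting_half_step a sigma (ubar n) (ubarh n).
  by move=> j; have [] := L n j.
(* The second half step computes index j from j and j + 1; shifting the new
   index by one brings it to the form of the first, and sums are unchanged. *)
have H2 : staggered_half_step a lambda sigma r e (uh n) (vh n)
    (fun j => u n.+1 (j - 1)) (fun j => v n.+1 (j - 1)).
  by move=> j; have [_ _] := U n (j - 1); rewrite subrK.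
have L2 : limiting_half_step a sigma (ubarh n) (fun j => ubar n.+1 (j - 1)).
  by move=> j; have [_] := L n (j - 1); rewrite subrK.
have E1 := energy_half_step erefl mu0 edt s3 e01 er c0 cE H1 L1.
have E2 := energy_half_step erefl mu0 edt s3 e01 er c0 cE H2 L2.
have J := jump_energy_le as1 L1.
have <- : energy mu a c (fun j => u n.+1 (j - 1)) (fun j => v n.+1 (j - 1))
   (fun j => ubar n.+1 (j - 1)) = energy mu a c (u n.+1) (v n.+1) (ubar n.+1).
  exact: (esum_shift (fun j => (mu * (u n.+1 j - ubar n.+1 j) ^+ 2
    + (1 + c) * (v n.+1 j - a * u n.+1 j) ^+ 2)%:E)).
apply: le_trans E2 _.
have -> : mu ^+ 2 * sigma ^+ 2 * eps / dt
  = mu ^+ 2 * sigma ^+ 2 / (4 * r) + mu ^+ 2 * sigma ^+ 2 / (4 * r).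
  by rewrite /r; field; rewrite !lt0r_neq0.
rewrite EFinD ge0_muleDl ?lee_fin // addeA leeD //.
by rewrite lee_wpmul2l ?lee_fin.
Qed.

Theorem theorem3 (R : realType) (a lambda eps dx dt T sigma : R)
    (u v uh vh ubar ubarh : nat -> int -> R) (um up K : R) :
  let U := fun (n : nat) (j : int) => state (u n j) (v n j) in
  let Ubar := fun (n : nat) (j : int) => state (ubar n j) (a * ubar n j) in
  let w := fun (n : nat) (j : int) => v n j - a * u n j in
  let Phi := fun n : nat => Phi_rel a lambda dx (U n) (Ubar n) in
  0 < lambda -> 0 < eps -> 0 < dx -> 0 < dt -> 0 < T ->
  sigma = dt / dx ->
  staggered_scheme a lambda eps dt sigma u v uh vh ->
  limiting_scheme a sigma ubar ubarh ->
  `|a| < lambda ->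
  lambda * sigma <= 1 / Num.sqrt 3 ->
  (Phi 0%N < +oo)%E ->
  (forall n : nat,
    [/\ cvg_pinfty_int (U n) (state up (a * up)),
        cvg_ninfty_int (U n) (state um (a * um)),
        cvg_pinfty_int (Ubar n) (state up (a * up)) &
        cvg_ninfty_int (Ubar n) (state um (a * um))]) ->
  0 < K ->
  (forall N : nat, N%:R * dt <= T ->
    (\sum_(0 <= n < N) ((dt * dx)%:E *
       \esum_(j in [set: int])
         (((ubar n (j + 1) - ubar n j) / dx) ^+ 2)%:E)
     <= (K ^+ 2)%:E)%E) ->
  forall N : nat, N%:R * dt <= T ->
    (Phi N + (kappa a lambda sigma * (dt / eps) * dx)%:E *
       (\esum_(j in [set: int]) ((w N j) ^+ 2)%:E)
     <= Phi 0%N + (kappa a lambda sigma * (dt / eps) * dx)%:E *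
       (\esum_(j in [set: int]) ((w 0%N j) ^+ 2)%:E)
       + ((lambda ^+ 2 - a ^+ 2) ^+ 2 / 2 * eps * K ^+ 2)%:E)%E.
Proof.
move=> U Ubar w Phi lambda0 eps0 dx0 dt0 _ sigmaE HU HL al ls _ _ K0 HK N NT.
set mu := lambda ^+ 2 - a ^+ 2.
have mu0 : 0 < mu.
  by rewrite subr_gt0 -[a ^+ 2]real_normK ?num_real // ltr_pXn2r // nnegrE // ltW.
have sigma0 : 0 < sigma by rewrite sigmaE divr_gt0.
have s3 : lambda ^+ 2 * sigma ^+ 2 <= 3^-1.
  rewrite -exprMn; have -> : 3^-1 = (1 / Num.sqrt 3) ^+ 2 :> R.
    by rewrite expr_div_n expr1n sqr_sqrtr // mul1r.
  by rewrite ler_pXn2r // nnegrE ?divr_ge0 ?sqrtr_ge0 // mulr_ge0 // ltW.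
pose c := 2 * (kappa a lambda sigma * (dt / eps)).
have kge0 : 0 <= kappa a lambda sigma * (dt / eps).
  rewrite mulr_ge0 ?divr_ge0 ?(ltW eps0) ?(ltW dt0) //; last by lra.
  by rewrite mulr_ge0 ?sqr_ge0 // ltW.
have dx2 : 0 <= dx / 2 by lra.
have PhiE n : (Phi n + (kappa a lambda sigma * (dt / eps) * dx)%:E *
    (\esum_(j in [set: int]) ((w n j) ^+ 2)%:E)
    = (dx / 2)%:E * energy mu a c (u n) (v n) (ubar n))%E.
  have -> : kappa a lambda sigma * (dt / eps) * dx = dx / 2 * c.
    by rewrite /c; move: (kappa _ _ _ * _) => k; field.
  have c0 : 0 <= c by rewrite /c mulr_ge0.
  have w0 j : (0 <= ((w n j) ^+ 2)%:E)%E by rewrite lee_fin sqr_ge0.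
  have p0 j : 0 <= mu * (u n j - ubar n j) ^+ 2 + w n j ^+ 2.
    by apply: addr_ge0 (sqr_ge0 _); rewrite mulr_ge0 ?sqr_ge0 // ltW.
  have -> : Phi n = ((dx / 2)%:E * \esum_(j in [set: int])
      (mu * (u n j - ubar n j) ^+ 2 + w n j ^+ 2)%:E)%E.
    congr (_ * _)%E; apply: eq_esum => j _; congr EFin.
    by rewrite /U /Ubar quadratic_entropy /w /mu; ring.
  rewrite (EFinM (dx / 2) c) -muleA -ge0_muleDr; first last.
  - by rewrite mule_ge0 ?lee_fin // esum_ge0.
  - by apply: esum_ge0 => j _; rewrite lee_fin.
  congr (_ * _)%E; rewrite -esumZ // -esumD //; last first.
  - by move=> j _; rewrite mule_ge0.
  - by move=> j _; rewrite lee_fin.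
  apply: eq_esum => j _; rewrite -EFinM -EFinD; congr EFin.
  by rewrite /w; ring.
rewrite !PhiE.
pose D n := ((dt * dx)%:E * \esum_(j in [set: int])
         (((ubar n (j + 1) - ubar n j) / dx) ^+ 2)%:E)%E.
have D0 n : (0 <= D n)%E.
  rewrite mule_ge0 ?lee_fin ?(ltW (mulr_gt0 dt0 dx0)) //.
  by apply: esum_ge0 => j _; rewrite lee_fin sqr_ge0.
have C0 : 0 <= mu ^+ 2 / 2 * eps.
  by rewrite mulr_ge0 ?(ltW eps0) // divr_ge0 ?sqr_ge0.
apply: le_trans (@telescope_sume_le _
  (fun n => (dx / 2)%:E * energy mu a c (u n) (v n) (ubar n))%E
  D (mu ^+ 2 / 2 * eps) N C0 D0 _) _; last first.
  by rewrite leeD2l // (EFinM _ (K ^+ 2)) lee_wpmul2l ?lee_fin // HK.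
move=> n _.
have -> : ((mu ^+ 2 / 2 * eps)%:E * D n = (dx / 2)%:E *
    ((mu ^+ 2 * sigma ^+ 2 * eps / dt)%:E * jump_energy (ubar n)))%E.
  have -> : D n = ((dt / dx)%:E * jump_energy (ubar n))%E.
    have -> : jump_energy (ubar n) =
        (\esum_(j in [set: int]) ((ubar n (j + 1) - ubar n j) ^+ 2)%:E)%E.
      rewrite /jump_energy -[LHS](esum_shift _ 1).
      by apply: eq_esum => j _; rewrite addrK.
    rewrite /D.
    rewrite -!esumZ ?(ltW (mulr_gt0 dt0 dx0)) ?(ltW (divr_gt0 dt0 dx0)) //;
      try by move=> j; rewrite lee_fin sqr_ge0.
    apply: eq_esum => j _; rewrite -!EFinM; congr EFin.
    by field; rewrite lt0r_neq0.
  rewrite !muleA -!EFinM; congr (_%:E * _)%E.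
  by rewrite sigmaE; field; rewrite !lt0r_neq0.
have E0 : (0 <= energy mu a c (u n) (v n) (ubar n))%E.
  apply: esum_ge0 => j _; rewrite lee_fin addr_ge0 //.
    by rewrite mulr_ge0 ?sqr_ge0 // ltW.
  by rewrite mulr_ge0 ?sqr_ge0 // addr_ge0 // /c mulr_ge0.
rewrite -ge0_muleDr //; last first.
  apply: mule_ge0; last by apply: esum_ge0 => j _; rewrite lee_fin sqr_ge0.
  by rewrite lee_fin divr_ge0 ?(ltW dt0) // mulr_ge0 ?(ltW eps0) // mulr_ge0 ?sqr_ge0.
apply: lee_wpmul2l; first by rewrite lee_fin.
exact: (energy_step n eps0 dt0 mu0 s3 HU HL).
Qed.
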